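(* Let $k\ge 3$ and $n\ge 2\lceil \log_{2}(k-1)\rceil + 4$, and let $\mathcal A$ be a $k$-wise eventown on $[n]$. If $|\mathcal A|> \frac{3}{4}2^{\lfloor n/2\rfloor}+(k-1)n$, then $\mathcal A$ is a subfamily of a family of one of the following two types: (i) there are $\lfloor n/2\rfloor$ pairwise disjoint subsets $B_1,\ldots,B_{\lfloor n/2\rfloor}$ of $[n]$, each of size $2$, and the family is $\mathcal B=\{\bigcup_{i\in S}B_i : S\subseteq[\lfloor n/2\rfloor]\}$; (ii) $n$ is odd, $B_1,\ldots,B_{\lfloor n/2\rfloor}$ and $\mathcal B$ are as in (i), $i\in[n]$ is the unique element not covered by $B_1,\ldots,B_{\lfloor n/2\rfloor}$, $C_1,\ldots,C_{k-1}$ are $k-1$ distinct sets of $\mathcal B$, and the family is $\mathcal B\cup\{C_1\cup\{i\},\ldots,C_{k-1}\cup\{i\}\}$.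
   Context: A family $\mathcal A=\{A_1,\ldots,A_m\}$ of distinct subsets of $[n]=\{1,\ldots,n\}$ is a $k$-wise eventown if $\left|\bigcap_{i\in S}A_i\right|$ is even for every $S\subseteq[m]$ with $|S|=k$. *)

(* Defs.v *)
From mathcomp Require Import all_boot all_order all_algebra.

Set Implicit Arguments.
Unset Strict Implicit.
Unset Printing Implicit Defensive.

(* The ground set [n] is 'I_n. A family of distinct sets is a finite set of
   sets, and S below picks k distinct members. *)
Definition kwise_eventown (k n : nat) (A : {set {set 'I_n}}) : Prop :=
  forall S : {set {set 'I_n}},
    S \subset A -> #|S| = k -> ~~ odd #|\bigcap_(X in S) X|.

Definition disjoint_pairs (n : nat) (B : 'I_n./2 -> {set 'I_n}) : Prop :=
  (forall j, #|B j| = 2) /\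
  (forall j1 j2, j1 != j2 -> [disjoint B j1 & B j2]).

Definition union_family (n : nat) (B : 'I_n./2 -> {set 'I_n}) :
    {set {set 'I_n}} :=
  [set \bigcup_(j in S) B j | S : {set 'I_n./2}].

Definition type_i (n : nat) (F : {set {set 'I_n}}) : Prop :=
  exists B : 'I_n./2 -> {set 'I_n}, disjoint_pairs B /\ F = union_family B.

Definition type_ii (k n : nat) (F : {set {set 'I_n}}) : Prop :=
  odd n /\
  exists (B : 'I_n./2 -> {set 'I_n}) (i : 'I_n) (C : 'I_(k - 1) -> {set 'I_n}),
    [/\ disjoint_pairs B,
        ~: (\bigcup_j B j) = [set i],
        injective C,
        forall l, C l \in union_family B
      & F = union_family B :|: [set C l :|: [set i] | l : 'I_(k - 1)]].

(* Main.v *)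
(* A largest odd-intersecting subfamily with fewer than k members meets each
   other member evenly. Deleting such subfamilies greedily costs at most
   (k - 1) n sets, and leaves A' with more than 3/4 2^(n/2) members whose triple
   intersections are all even.
   A maximal triple-even family V containing A' is a subspace of F_2^n with more
   than half of the size that the eventown bound allows, so V contains every
   even set orthogonal to it, in particular the products of its members. Hence V
   is a ring of sets; its atoms are even and there are at least floor(n/2) of
   them, so they are floor(n/2) disjoint pairs B_j.
   If some X in A met B_j in one point, then, since A contains more than 3/4 of
   V, it would contain both some Y in V that includes B_j and the union of B_j
   with the pairs outside Y, and these extend to k - 1 members of A with
   intersection exactly B_j, which X meets oddly. So A lies in V up to the
   uncovered point, and k members of A through that point would have an odd
   intersection. *)
Require Import Defs.
From mathcomp Require Import all_boot all_order all_algebra.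
From mathcomp Require Import mxabelem zify lra.
Import Order.TTheory GRing.Theory Num.Theory.

Set Implicit Arguments.
Unset Strict Implicit.
Unset Printing Implicit Defensive.

(** * Preliminaries on finite sets *)

Lemma intermediate_subset (T : finType) (A B : {set T}) m :
  A \subset B -> #|A| <= m <= #|B| ->
  exists S : {set T}, [/\ A \subset S, S \subset B & #|S| = m].
Proof.
move=> sAB /andP[]; elim: m => [|m IHm] leAm lemB.
  by exists A; split=> //; apply/eqP; rewrite -leqn0.
move: leAm; rewrite leq_eqVlt => /predU1P[<-|leAm]; first by exists A.
have [|S [sAS sSB cS]] := IHm _ (ltnW lemB); first by [].
have /card_gt0P[x] : 0 < #|B :\: S| by rewrite cardsDS // subn_gt0 cS.
rewrite inE => /andP[xS xB]; exists (x |: S); split.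
- by rewrite subsetU // sAS orbT.
- by rewrite subUset sub1set xB.
- by rewrite cardsU1 xS cS.
Qed.

Lemma card_set_ord d : #|{set 'I_d}| = 2 ^ d.
Proof. by rewrite -cardsT -powersetT card_powerset cardsT card_ord. Qed.

(** * Parity of symmetric differences and greedy deletion *)

Section SymmetricDifference.
Variable T : finType.
Implicit Types (X Y Z D : {set T}) (U : {set {set T}}).

Definition symdiff X Y := [set i | (i \in X) (+) (i \in Y)].

Lemma symdiffK Y : involutive (symdiff Y).
Proof. by move=> X; apply/setP=> i; rewrite !inE addKb. Qed.

Lemma symdiffC X Y : symdiff X Y = symdiff Y X.
Proof. by apply/setP=> i; rewrite !inE addbC. Qed.

Lemma symdiffIl X Y Z : symdiff X Y :&: Z = symdiff (X :&: Z) (Y :&: Z).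
Proof. by apply/setP=> i; rewrite !inE andb_addl. Qed.

Lemma symdiffIr X Y Z : Z :&: symdiff X Y = symdiff (Z :&: X) (Z :&: Y).
Proof. by rewrite setIC symdiffIl ![_ :&: Z]setIC. Qed.

Lemma odd_card_symdiff X Y : odd #|symdiff X Y| = odd #|X| (+) odd #|Y|.
Proof.
have oddE Z : odd #|Z| = \big[addb/false]_i (i \in Z).
  rewrite -sum1_card (big_morph odd oddD (erefl _)) big_mkcond /=.
  by apply: eq_bigr => i _; case: ifP.
by rewrite !oddE -big_split; apply: eq_bigr => i _; rewrite inE.
Qed.

Definition symdiff_closed U :=
  forall X Y, X \in U -> Y \in U -> symdiff X Y \in U.

(** Translation by [X] injects the members meeting [D] evenly into those meeting it oddly. *)
Lemma card_even_with U D X : symdiff_closed U -> X \in U -> odd #|X :&: D| ->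
  2 * #|[set Y in U | ~~ odd #|Y :&: D|]| <= #|U|.
Proof.
move=> clU XU oX; set V := [set Y in U | _].
rewrite mul2n -addnn -{2}(card_imset _ (can_inj (symdiffK X))).
rewrite -(cardsID V U) leq_add //; apply: subset_leq_card; apply/subsetP=> Y.
  by rewrite inE => /[dup] /andP[YU _]; rewrite !inE YU.
case/imsetP=> Z; rewrite inE => /andP[ZU eZ] ->.
by rewrite !inE clU // symdiffIl odd_card_symdiff oX (negPf eZ).
Qed.

End SymmetricDifference.

(* Each deletion confines the family to the members of the ambient group [U]
   that meet the odd intersection evenly, which halves [U]; hence at most [m]
   deletions. *)
Lemma strongly_eventown_subfamily k n m (U A : {set {set 'I_n}}) :
  kwise_eventown k A -> symdiff_closed U -> A \subset U -> #|U| <= 2 ^ m ->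
  exists A' : {set {set 'I_n}}, [/\ A' \subset A, #|A| <= #|A'| + (k - 1) * m &
    forall S : {set {set 'I_n}}, S \subset A' -> 0 < #|S| <= k ->
      ~~ odd #|\bigcap_(X in S) X| ].
Proof.
have [N] := ubnP #|U|; elim: N => // N IHN in m U A *.
move=> leUN evA clU sAU leU.
pose P (S : {set {set 'I_n}}) :=
  [&& S \subset A, 0 < #|S| < k & odd #|\bigcap_(X in S) X|].
have [/existsP[S0 PS0]|/existsPn noP] := boolP [exists S, P S]; last first.
  exists A; split=> [||S sSA /andP[S0 Sk]]; rewrite ?leq_addr //.
  apply/negP=> oS; case/negP: (noP S).
  rewrite /P sSA S0 oS ltn_neqAle Sk !andbT.
  by apply/eqP=> cS; move: (evA S sSA cS); rewrite oS.
case: (arg_maxnP (fun S : {set {set 'I_n}} => #|S|) PS0)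
  => S /and3P[sSA /andP[S_gt0 Sk] oS] maxS.
set D := \bigcap_(X in S) X in oS.
have /card_gt0P[X XS] := S_gt0.
have DX : X :&: D = D by apply/setIidPr; apply: bigcap_inf XS.
have XU : X \in U by apply: (subsetP sAU); apply: (subsetP sSA).
have := card_even_with clU XU (D := D); rewrite DX => /(_ oS).
set V := [set Y in U | _] => leV.
(* Nonemptiness rules out [m = 0], where [U] has at most one member, and makes [V] smaller than [U]
   for the induction. *)
have V_gt0 : 0 < #|V|.
  apply/card_gt0P; exists (symdiff X X).
  by rewrite inE clU // symdiffIl odd_card_symdiff addbb.
have evA2 : kwise_eventown k (A :\: S).
  by move=> R /subsetDP[sRA _]; apply: evA.
have clV : symdiff_closed V.
  move=> Y Z; rewrite !inE => /andP[YU eY] /andP[ZU eZ].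
  by rewrite clU // symdiffIl odd_card_symdiff (negPf eY) (negPf eZ).
have sA2 : A :\: S \subset V.
  apply/subsetP=> Y; rewrite !inE => /andP[YS YA].
  (* If [Y] met [D] oddly, [Y |: S] would either be [k] members with odd intersection or contradict
     the maximality of [S]. *)
  rewrite (subsetP sAU) //=; apply/negP=> oY.
  have cYS : #|Y |: S| = #|S|.+1 by rewrite cardsU1 YS.
  have sYS : Y |: S \subset A by rewrite subUset sub1set YA.
  have eYS : \bigcap_(Z in Y |: S) Z = Y :&: D by rewrite bigcap_setU big_set1.
  have [cS|ltS] := eqVneq #|S|.+1 k.
    by move: (evA _ sYS); rewrite cYS eYS oY => /(_ cS).
  have {}ltS : #|S|.+1 < k by rewrite ltn_neqAle ltS.
  by have := maxS (Y |: S); rewrite /P sYS cYS eYS oY ltS /= ltnn => /(_ isT).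
case: m leU => [|m]; first by lia.
rewrite expnS => leU.
have [||A' [sA' cA' evA']] := IHN m V _ _ evA2 clV sA2; try lia.
exists A'; split=> //; first by apply: subset_trans sA' _; apply: subsetDl.
have := cardsID S A; rewrite (setIidPr sSA) mulnS; lia.
Qed.

(** * The eventown bound and triple-even families *)

Lemma eventown_bound n (E : {set {set 'I_n}}) :
  {in E &, forall X Y, ~~ odd #|X :&: Y|} -> #|E| <= 2 ^ n./2.
Proof.
move=> evE; pose ind (X : {set 'I_n}) : 'rV['F_2]_n := (\row_j (j \in X)%:R)%R.
pose M : 'M['F_2]_(#|E|, n) := (\matrix_i ind (enum_val i))%R.
(* The rows of [M] span a self-orthogonal space, so its dimension is at most [n./2]; it contains all
   the indicator vectors. *)
have MMt : (M *m M^T = 0)%R.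
  apply/matrixP=> i j; rewrite !mxE.
  have := evE _ _ (enum_valP i) (enum_valP j).
  set X := enum_val i; set Y := enum_val j => eXY.
  transitivity (#|X :&: Y|%:R : 'F_2)%R.
    rewrite -[in RHS]sum1_card natr_sum [RHS]big_mkcond; apply: eq_bigr => l _.
    rewrite !mxE inE.
    by do 2 case: (_ \in _); rewrite /= ?(mulr1, mulr0, mul0r).
  rewrite -(odd_double_half #|_|) (negPf eXY) add0n -muln2 natrM.
  by rewrite (_ : 2%:R = 0 :> 'F_2)%R ?mulr0 //; apply/val_inj.
have rkM : \rank M <= n./2.
  have := mulmx0_rank_max MMt; rewrite mxrank_tr; lia.
have indI : injective ind.
  move=> X Y /rowP eXY; apply/setP=> j; have := eXY j; rewrite !mxE.
  by do 2 case: (_ \in _).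
rewrite -(card_imset _ indI) (@leq_trans #|rowg M|) //; last first.
  by rewrite card_rowg card_Fp // leq_exp2l.
apply/subset_leq_card/subsetP=> _ /imsetP[X XE ->]; rewrite inE.
have -> : ind X = row (enum_rank_in XE X) M by rewrite rowK enum_rankK_in.
exact: row_sub.
Qed.

(** Repetitions are allowed, so sizes and pairwise intersections of members are even too. *)
Definition triple_even (T : finType) (V : {set {set T}}) :=
  [forall X in V, forall Y in V, forall Z in V, ~~ odd #|X :&: Y :&: Z|].

Lemma triple_evenP (T : finType) (V : {set {set T}}) :
  reflect {in V & &, forall X Y Z, ~~ odd #|X :&: Y :&: Z|} (triple_even V).
Proof.
apply: (iffP forall_inP) => [evV X Y Z XV YV ZV|evV X XV].
  by have /forall_inP/(_ Y YV)/forall_inP/(_ Z ZV) := evV X XV.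
by apply/forall_inP=> Y YV; apply/forall_inP=> Z ZV; apply: evV.
Qed.

(** Parity is additive in each slot of the triple intersection. Hence a maximal triple-even family
    is closed under [symdiff]. *)
Lemma triple_even_add (T : finType) (V : {set {set T}}) X Y :
  triple_even V -> X \in V -> Y \in V -> triple_even (symdiff X Y |: V).
Proof.
move=> /triple_evenP evV XV YV; set W := symdiff X Y.
have evW1 Z1 Z2 : Z1 \in V -> Z2 \in V -> ~~ odd #|W :&: Z1 :&: Z2|.
  move=> Z1V Z2V; rewrite !symdiffIl odd_card_symdiff.
  by rewrite (negPf (evV _ _ _ _ _ _)) // (negPf (evV _ _ _ _ _ _)).
have evW2 Z : Z \in V -> ~~ odd #|W :&: Z|.
  move=> ZV; rewrite symdiffIl odd_card_symdiff.
  rewrite -{1}(setIid X) -{1}(setIid Y).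
  by rewrite (negPf (evV _ _ _ _ _ _)) // (negPf (evV _ _ _ _ _ _)).
have evW : ~~ odd #|W|.
  by rewrite -(setIid W) {2}/W symdiffIr odd_card_symdiff !(negPf (evW2 _ _)).
apply/triple_evenP=> Z1 Z2 Z3; rewrite !inE.
case/predU1P=> [->|Z1V] /predU1P[->|Z2V] /predU1P[->|Z3V].
- by rewrite !setIid.
- by rewrite setIid evW2.
- by rewrite setIAC setIid evW2.
- exact: evW1.
- by rewrite -setIA setIid setIC evW2.
- by rewrite [Z1 :&: W]setIC evW1.
- by rewrite setIC setIA evW1.
- exact: evV.
Qed.

(* [V] together with its translate by [Z] is pairwise even, so a new [Z] would
   double [V] beyond the eventown bound. *)
Lemma eventown_maximal n (V : {set {set 'I_n}}) (Z : {set 'I_n}) :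
    {in V &, forall X Y, ~~ odd #|X :&: Y|} -> symdiff_closed V ->
    2 ^ n./2 < 2 * #|V| ->
    ~~ odd #|Z| -> {in V, forall X, ~~ odd #|X :&: Z|} ->
  Z \in V.
Proof.
move=> evV clV ltV evZ evVZ; apply/negPn/negP=> ZV.
pose V' := [set symdiff Z X | X in V].
have cV' : #|V'| = #|V| by apply/card_imset/can_inj/symdiffK.
have dV : [disjoint V & V'].
  rewrite disjoints_subset; apply/subsetP=> X XV; rewrite inE.
  apply/imsetP=> -[Y YV eX]; case/negP: ZV.
  by rewrite -(symdiffK Y Z) [symdiff Y Z]symdiffC -eX clV.
have evVV' X Y : X \in V -> Y \in V' -> ~~ odd #|X :&: Y|.
  move=> XV /imsetP[Y' Y'V ->]; rewrite symdiffIr odd_card_symdiff.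
  by rewrite (negPf (evVZ _ XV)) (negPf (evV _ _ XV Y'V)).
have evV' X Y : X \in V' -> Y \in V' -> ~~ odd #|X :&: Y|.
  move=> /imsetP[X' X'V ->] YV'; rewrite symdiffIl odd_card_symdiff.
  rewrite (negPf (evVV' _ _ X'V YV')).
  case/imsetP: YV' => Y' Y'V ->; rewrite symdiffIr odd_card_symdiff setIid.
  by rewrite [Z :&: _]setIC (negPf (evVZ _ Y'V)) (negPf evZ).
have : #|V :|: V'| <= 2 ^ n./2.
  apply: eventown_bound => X Y; rewrite !inE.
  move=> /orP[XV|XV] /orP[YV|YV]; [exact: evV|exact: evVV'| |exact: evV'].
  by rewrite setIC evVV'.
move: (leq_card_setU V V'); rewrite dV => -[_ /eqP ->]; rewrite cV'; lia.
Qed.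

(** * Atoms of a ring of sets *)

Section Atoms.
Variables (T : finType) (V : {set {set T}}).
Hypothesis clI : forall X Y, X \in V -> Y \in V -> X :&: Y \in V.
Hypothesis clD : forall X Y, X \in V -> Y \in V -> X :\: Y \in V.

Definition atoms := preim_partition (fun i => [set X in V | i \in X]) (cover V).

Lemma atoms_partition : partition atoms (cover V).
Proof. exact: preim_partitionP. Qed.

Lemma atom_min C X i :
  C \in atoms -> X \in V -> i \in C -> i \in X -> C \subset X.
Proof.
case/imsetP=> j _ -> XV; rewrite !inE => /andP[_ /eqP eij] iX.
apply/subsetP=> l; rewrite !inE => /andP[_ /eqP ejl].
have: X \in [set X in V | i \in X] by rewrite inE XV.
by rewrite -eij ejl inE => /andP[].
Qed.

(** The atom of [i] is the smallest member [X] containing [i]: if some member [Y] contained a point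
    of [X] but not [i], then [X :\: Y] would be a smaller one. *)
Lemma atom_in C : C \in atoms -> C \in V.
Proof.
move=> CA; case/imsetP: (CA) => i /bigcupP[X0 X0V iX0] eC.
have iC : i \in C by rewrite eC !inE eqxx andbT; apply/bigcupP; exists X0.
have [|X /andP[XV iX] minX] := @arg_minnP _ X0
  (fun X : {set T} => (X \in V) && (i \in X)) (fun X : {set T} => #|X|).
  by rewrite X0V.
suff -> : C = X by [].
have sX Y : Y \in V -> i \in Y -> X \subset Y.
  move=> YV iY; apply/setIidPl/eqP; rewrite eqEcard subsetIl.
  by apply: minX; rewrite clI // inE iX.
apply/eqP; rewrite eqEsubset (atom_min CA XV iC iX) eC; apply/subsetP=> j jX.
rewrite !inE; apply/andP; split; first by apply/bigcupP; exists X.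
apply/eqP/setP=> Y; rewrite !inE; case YV: (Y \in V) => //=.
apply/idP/idP=> [/(sX _ YV)/subsetP->//|jY].
apply/negPn/negP=> iY; have /subsetP/(_ j jX) : X \subset X :\: Y.
  by apply: sX; rewrite ?clD // inE iY iX.
by rewrite inE jY.
Qed.

Lemma cover_atoms X : X \in V -> X = \bigcup_(C in atoms | C \subset X) C.
Proof.
move=> XV; apply/setP=> i; apply/idP/bigcupP=> [iX|]; last first.
  by case=> C /andP[_ /subsetP]; apply.
have : i \in cover atoms.
  rewrite (cover_partition atoms_partition); apply/bigcupP; exists X => //.
case/bigcupP=> C CA iC; exists C => //.
by rewrite CA (atom_min CA XV iC iX).
Qed.

(** A member is determined by the atoms below it. *)
Lemma card_le_atoms : #|V| <= 2 ^ #|atoms|.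
Proof.
rewrite -card_powerset.
pose below (X : {set T}) := [set C in atoms | C \subset X].
rewrite -(card_in_imset (f := below) (D := V)).
  apply/subset_leq_card/subsetP=> _ /imsetP[X _ ->]; rewrite inE.
  by apply/subsetP=> C; rewrite inE => /andP[].
move=> X Y XV YV /setP eXY; rewrite (cover_atoms XV) (cover_atoms YV).
by apply: eq_bigl => C; have := eXY C; rewrite !inE.
Qed.

End Atoms.

(** * From large triple-even families to disjoint pairs *)

Lemma triple_even_pairs n (A : {set {set 'I_n}}) :
    triple_even A -> 2 ^ n./2 < 2 * #|A| ->
  exists B : 'I_n./2 -> {set 'I_n},
    disjoint_pairs B /\ A \subset union_family B.
Proof.
move=> evA ltA; have [V /maxsetP[evV maxV] sAV] := maxset_exists evA.
have {ltA} ltV : 2 ^ n./2 < 2 * #|V| by have := subset_leq_card sAV; lia.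
have clV : symdiff_closed V.
  move=> X Y XV YV; rewrite -(maxV _ (triple_even_add evV XV YV)) ?subsetUr //.
  by rewrite setU11.
have /triple_evenP evV3 := evV.
have evV2 : {in V &, forall X Y, ~~ odd #|X :&: Y|}.
  by move=> X Y XV YV; rewrite -(setIid X) evV3.
have clI X Y : X \in V -> Y \in V -> X :&: Y \in V.
  (* Even triple intersections say that [X :&: Y] is orthogonal to [V]. *)
  move=> XV YV; apply: eventown_maximal => //; first exact: evV2.
  by move=> Z ZV; rewrite setIA evV3.
have clD X Y : X \in V -> Y \in V -> X :\: Y \in V.
  move=> XV YV.
  have -> : X :\: Y = symdiff X (X :&: Y); last by rewrite clV ?clI.
  by apply/setP=> i; rewrite !inE; do 2 case: (i \in _).
pose P := atoms V; have partP := atoms_partition V.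
have PV C : C \in P -> C \in V by apply: atom_in.
have P2 C : C \in P -> 2 <= #|C|.
  move=> CP; have := evV2 _ _ (PV _ CP) (PV _ CP); rewrite setIid.
  have : #|C| != 0.
    rewrite cards_eq0; apply: contraTneq CP => ->.
    by case/and3P: partP.
  by case: #|C| => [|[|]].
have sumP : \sum_(C in P) #|C| <= n.
  by rewrite -(card_partition partP) -[leqRHS]card_ord max_card.
have cP : #|P| = n./2.
  have leP : 2 * #|P| <= n.
    apply: leq_trans sumP; rewrite mulnC -sum_nat_const; exact: leq_sum.
  have : 2 ^ n./2 < 2 ^ #|P|.+1.
    by rewrite expnS; have := card_le_atoms V; rewrite -/P; lia.
  rewrite ltn_exp2l //; lia.
(* The other atoms occupy at least [2 * (n./2 - 1)] points, which leaves at most three for [C]; its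
   size is even. *)
have cP2 C : C \in P -> #|C| = 2.
  move=> CP; have := sumP; rewrite (bigD1 C) //=.
  have : \sum_(D in P | D != C) 2 <= \sum_(D in P | D != C) #|D|.
    by apply: leq_sum => D /andP[/P2].
  rewrite sum_nat_const.
  have <- : #|P :\ C| = #|[pred D | (D \in P) && (D != C)]|.
    by apply: eq_card => D; rewrite !inE andbC.
  have := cardsD1 C P; rewrite CP cP.
  have := evV2 _ _ (PV _ CP) (PV _ CP); rewrite setIid.
  have := P2 _ CP; have := odd_double_half n; have := odd_double_half #|C|.
  case: (odd n); case: (odd #|C|) => //=; lia.
exists (fun j => enum_val (cast_ord (esym cP) j)); split.
  split=> [j|j1 j2 j12]; first exact/cP2/enum_valP.
  have /trivIsetP := partition_trivIset partP; apply; try exact: enum_valP.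
  by apply: contra j12 => /eqP/enum_val_inj/cast_ord_inj ->.
apply/subsetP=> X /(subsetP sAV) XV; apply/imsetP.
exists [set j | enum_val (cast_ord (esym cP) j) \subset X] => //.
rewrite {1}(cover_atoms XV); apply/setP=> i; apply/bigcupP/bigcupP.
  case=> C /andP[CP sCX] iC; exists (cast_ord cP (enum_rank_in CP C)).
    by rewrite inE cast_ordK enum_rankK_in.
  by rewrite cast_ordK enum_rankK_in.
case=> j; rewrite inE => sjX ij; exists (enum_val (cast_ord (esym cP) j)) => //.
by rewrite enum_valP.
Qed.

(** More than half of the sets containing [j] lie in [Y], so [Y] contains two of them, [Z] and
    [c Z], that meet only in [j]. Further sets of [Y] through [j] bring the number up to [m]. *)
Lemma singleton_intersection d m (Y : {set {set 'I_d}}) (j : 'I_d) :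
    2 <= m -> 4 * m <= 2 ^ d -> 3 * 2 ^ d < 4 * #|Y| ->
  exists S : {set {set 'I_d}},
    [/\ S \subset Y, #|S| = m & \bigcap_(Z in S) Z = [set j]].
Proof.
move=> m_ge2 led ltY.
pose N := powerset (~: [set j]).
have cN : 2 * #|N| = 2 ^ d.
  by rewrite card_powerset cardsC1 card_ord -expnS prednK //
    (leq_ltn_trans _ (ltn_ord j)).
have cNC : #|~: N| = #|N|.
  by have := cardsC N; rewrite card_set_ord; lia.
have inN Z : (Z \in N) = (j \notin Z).
  by rewrite inE -disjoints_subset disjoint_sym disjoints1.
have cYN : #|N| < 2 * #|Y :\: N|.
  have := cardsID N Y; have := subset_leq_card (subsetIr Y N).
  (* lia needs the cardinals of [Y] to be syntactically equal. *)
  rewrite /reverse_coercion in ltY *; lia.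
pose c (Z : {set 'I_d}) := ~: Z :|: [set j].
have [Z ZYN cZ] : exists2 Z, Z \in Y :\: N & c Z \in Y.
  apply/exists_inP; apply: contraT => /exists_inPn noZ.
  have cI : {in Y :\: N &, injective c}.
    move=> Z1 Z2; rewrite !in_setD !inN !negbK => /andP[jZ1 _] /andP[jZ2 _].
    move=> /setP eZ; apply/setP=> i; have := eZ i; rewrite !inE.
    have [->|_] := eqVneq i j; first by rewrite jZ1 jZ2.
    by rewrite !orbF => /negb_inj.
  have : #|(Y :\: N) :|: c @: (Y :\: N)| <= #|~: N|.
    apply/subset_leq_card; rewrite subUset subDset setUCr subsetT /=.
    by apply/subsetP=> _ /imsetP[Z _ ->]; rewrite in_setC inN !inE eqxx orbT.
  have : [disjoint Y :\: N & c @: (Y :\: N)].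
    rewrite disjoints_subset; apply/subsetP=> Z; rewrite !in_setD in_setC.
    case/andP=> _ ZY; apply/imsetP=> -[Z' Z'YN eZ].
    by have := noZ Z' Z'YN; rewrite -eZ ZY.
  move: (leq_card_setU (Y :\: N) (c @: (Y :\: N))) => [_ /esym].
  move=> -> /eqP ->; rewrite card_in_imset // cNC addnn -mul2n.
  by rewrite leqNgt cYN.
have cI : Z :&: c Z = [set j].
  move: ZYN; rewrite in_setD inN negbK => /andP[jZ _].
  by rewrite setIUr setICr set0U; apply/setIidPr; rewrite sub1set.
(* Equality would force [d = 1], against [4 * m <= 2 ^ d]. *)
have ZcZ : Z != c Z.
  apply/eqP=> eZ; have jZ : Z = [set j] by rewrite -cI -eZ setIid.
  have jT : [set j] = setT by rewrite -jZ eZ /c jZ setUC setUCr.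
  have := congr1 (fun X : {set 'I_d} => #|X|) jT.
  by rewrite /= cards1 cardsT card_ord => d1; move: led; rewrite -d1; lia.
have cZYN : c Z \in Y :\: N by rewrite in_setD inN negbK cZ !inE eqxx orbT.
have [||S [sZS sSY cS]] := @intermediate_subset _ [set Z; c Z] (Y :\: N) m.
- by rewrite subUset !sub1set ZYN.
- by rewrite cards2 ZcZ m_ge2; lia.
exists S; split=> //; first by apply: subset_trans sSY (subsetDl _ _).
apply/eqP; rewrite eqEsubset; apply/andP; split.
  by rewrite -cI subsetI !bigcap_inf // (subsetP sZS) // !inE eqxx ?orbT.
rewrite sub1set; apply/bigcapP=> X /(subsetP sSY).
by rewrite in_setD inN negbK => /andP[].
Qed.

(** * Unions of disjoint pairs *)

Section DisjointPairs.
Variables (n : nat) (B : 'I_n./2 -> {set 'I_n}).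
Hypothesis pairsB : disjoint_pairs B.
Implicit Types (S : {set 'I_n./2}) (X : {set 'I_n}).

Let bigB S := \bigcup_(j in S) B j.

Lemma pair_index_inj i j1 j2 : i \in B j1 -> i \in B j2 -> j1 = j2.
Proof.
move=> ij1 ij2; apply/eqP/negPn/negP=> /(pairsB.2 _ _)/disjointFr/(_ ij1).
by rewrite ij2.
Qed.

Lemma bigcup_pairsI S j : bigB S :&: B j = if j \in S then B j else set0.
Proof.
apply/setP=> i; rewrite inE; case: ifP => jS; last first.
  rewrite inE; apply/negP=> /andP[/bigcupP[l lS il] ij].
  by rewrite -(pair_index_inj il ij) lS in jS.
by apply/andP/idP=> [[]//|ij]; split=> //; apply/bigcupP; exists j.
Qed.

Lemma pair_neq0 j : B j != set0.
Proof. by rewrite -cards_eq0 pairsB.1. Qed.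

Lemma bigcup_pairs_inj : injective bigB.
Proof.
move=> S1 S2 eS; apply/setP=> j; have := bigcup_pairsI S1 j.
rewrite eS bigcup_pairsI; have /eqP := pair_neq0 j.
by do 2 case: ifP => // _; first by move=> + /esym.
Qed.

Lemma card_bigcup_pairs S : #|bigB S| = 2 * #|S|.
Proof.
rewrite /bigB big_mkcond -sum1_card /= partition_disjoint_bigcup /=.
  rewrite -sum1_card big_distrr [RHS]big_mkcond /=; apply: eq_bigr => j _.
  by rewrite sum1_card; case: ifP => _; rewrite ?cards0 ?pairsB.1.
by move=> j1 j2 /(pairsB.2 _ _) d12; rewrite -setI_eq0; do 2 case: ifP => _;
  rewrite ?setI0 ?set0I // setI_eq0.
Qed.

Lemma even_meet_pair X j :
  ~~ odd #|X :&: B j| -> X :&: B j = set0 \/ B j \subset X.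
Proof.
move=> evX; have := subset_leq_card (subsetIr X (B j)); rewrite pairsB.1.
case cX: #|_| evX => [|[|[|]]] // _ _; first by left; apply: cards0_eq.
by right; apply/setIidPr/eqP; rewrite eqEcard subsetIr cX pairsB.1.
Qed.

(** Each member contains or misses the pair, hence so does the intersection. *)
Lemma even_meet_bigcap (S : {set {set 'I_n}}) j :
    (forall X, X \in S -> ~~ odd #|X :&: B j|) ->
  ~~ odd #|(\bigcap_(X in S) X) :&: B j|.
Proof.
move=> evS; set Z := \bigcap_(X in S) X.
have [/forall_inP sBS|/forall_inPn[X XS nsX]] :=
  boolP [forall X in S, B j \subset X].
  by rewrite (setIidPr _) ?pairsB.1 //; apply/bigcapsP.
have [X0|sX] := even_meet_pair (evS X XS); last by rewrite sX in nsX.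
suff -> : Z :&: B j = set0 by rewrite cards0.
by apply/eqP; rewrite -subset0 -X0 setSI // bigcap_inf.
Qed.

Lemma bigcup_pairs_all_even X : (forall j, ~~ odd #|X :&: B j|) ->
  X :&: \bigcup_j B j = bigB [set j | B j \subset X].
Proof.
move=> evX; apply/setP=> i; rewrite inE.
apply/andP/bigcupP=> [[iX /bigcupP[j _ ij]]|[j]].
  exists j => //; rewrite inE; case: (even_meet_pair (evX j)) => // /setP/(_ i).
  by rewrite !inE iX ij.
by rewrite inE => /subsetP sjX ij; split; [exact: sjX|apply/bigcupP; exists j].
Qed.

Lemma bigcap_bigcup_pairs (W : {set {set 'I_n./2}}) j :
  0 < #|W| -> \bigcap_(S in W) S = [set j] -> \bigcap_(X in bigB @: W) X = B j.
Proof.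
move=> /card_gt0P[S0 S0W] eW.
have inW l : (l == j) = [forall S in W, l \in S].
  by rewrite -in_set1 -eW; apply/bigcapP/forall_inP.
apply/setP=> i; apply/bigcapP/idP=> [iW|ij _ /imsetP[S SW ->]].
  have /bigcupP[l lS0 il] := iW _ (imset_f _ S0W).
  suff /eqP <- : l == j by [].
  rewrite inW; apply/forall_inP=> S SW.
  by have /bigcupP[l' l'S /(pair_index_inj il) ->] := iW _ (imset_f _ SW).
apply/bigcupP; exists j => //.
by have := inW j; rewrite eqxx => /esym/forall_inP; apply.
Qed.

Lemma card_union_family : #|union_family B| = 2 ^ n./2.
Proof.
by rewrite /union_family card_imset ?card_set_ord //; apply: bigcup_pairs_inj.
Qed.

Lemma pairs_meet_evenly k (A : {set {set 'I_n}}) X j :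
    3 <= k -> 4 * (k - 1) <= 2 ^ n./2 -> kwise_eventown k A ->
    3 * 2 ^ n./2 < 4 * #|A :&: union_family B| -> X \in A ->
  ~~ odd #|X :&: B j|.
Proof.
move=> hk le2 evA ltA XA; apply/negP=> oX.
pose Y := [set S | bigB S \in A].
have ltY : 3 * 2 ^ n./2 < 4 * #|Y|.
  apply: leq_trans ltA _; rewrite leq_mul2l /= -(card_imset Y bigcup_pairs_inj).
  apply/subset_leq_card/subsetP=> Z; rewrite inE => /andP[ZA /imsetP[S _ eZ]].
  by rewrite eZ imset_f // inE /bigB -eZ.
have [|W [sWY cW eW]] := singleton_intersection j _ le2 ltY; first by lia.
(* Unions of pairs meet [B j] in 0 or 2 points, so [X] is a new member and the count is exactly
   [k]. *)
have XW : X \notin bigB @: W.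
  apply/imsetP=> -[S _ eX]; move: oX; rewrite eX bigcup_pairsI.
  by case: ifP; rewrite ?cards0 ?pairsB.1.
have := evA (X |: bigB @: W).
rewrite cardsU1 XW (card_imset _ bigcup_pairs_inj) cW bigcap_setU big_set1.
rewrite (bigcap_bigcup_pairs _ eW) ?cW; last by lia.
rewrite oX => evX; suff : ~~ true by []; apply: evX; last by lia.
rewrite subUset sub1set XA; apply/subsetP=> _ /imsetP[S SW ->].
by have := subsetP sWY S SW; rewrite inE.
Qed.

End DisjointPairs.

(** * The structure theorem *)

Lemma kwise_eventown_structure k n (A : {set {set 'I_n}}) :
    3 <= k -> 2 * up_log 2 (k - 1) + 4 <= n -> kwise_eventown k A ->
    3 * 2 ^ n./2 + 4 * ((k - 1) * n) < 4 * #|A| ->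
  exists F : {set {set 'I_n}}, (type_i F \/ type_ii k F) /\ A \subset F.
Proof.
move=> hk hn hA hcard.
(* Halving [hn] gives [up_log 2 (k - 1) + 2 <= n./2]; the summand 2 supplies the factor 4. *)
have le2 : 4 * (k - 1) <= 2 ^ n./2.
  have : k - 1 <= 2 ^ up_log 2 (k - 1) by apply: up_logP.
  have : 2 ^ (up_log 2 (k - 1)).+2 <= 2 ^ n./2 by rewrite leq_exp2l //; lia.
  rewrite !expnS; lia.
have [|||A' [sA'A cA' evA']] := @strongly_eventown_subfamily k n n setT A hA.
- by move=> X Y _ _; rewrite inE.
- exact: subsetT.
- by rewrite cardsT card_set_ord.
have ltA' : 3 * 2 ^ n./2 < 4 * #|A'| by lia.
have tA' : triple_even A'.
  (* Even with coincidences, [[set X; Y; Z]] has between 1 and 3 members, and [3 <= k]. *)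
  apply/triple_evenP=> X Y Z XA YA ZA.
  have := evA' [set X; Y; Z]; rewrite bigcap_setU bigcap_setU !big_set1; apply.
    by rewrite !subUset !sub1set XA YA.
  have := cardsU1 Z [set X; Y]; rewrite setUC cards2 => ->; lia.
have [|B [pairsB sA'B]] := triple_even_pairs tA'; first by lia.
set U := union_family B in sA'B.
have ltAU : 3 * 2 ^ n./2 < 4 * #|A :&: U|.
  apply: leq_trans ltA' _; rewrite leq_mul2l /=.
  by apply/subset_leq_card; rewrite subsetI sA'A.
have evAB X j : X \in A -> ~~ odd #|X :&: B j|.
  exact: (pairs_meet_evenly pairsB j hk le2 hA ltAU).
pose D := \bigcup_j B j.
have inU X : (forall j, ~~ odd #|X :&: B j|) -> X :&: D \in U.
  by move=> /(bigcup_pairs_all_even pairsB) ->; apply/imset_f.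
have cD : #|D| = 2 * n./2.
  have -> : D = \bigcup_(j in setT) B j by apply: eq_bigl => j; rewrite inE.
  by rewrite (card_bigcup_pairs pairsB) cardsT card_ord.
have cCD : #|~: D| = odd n.
  have := cardsC D; rewrite card_ord; have := odd_double_half n; lia.
have [on|en] := boolP (odd n); last first.
  exists U; split; first by left; exists B.
  apply/subsetP=> X XA; have DT : D = setT.
    by apply: setC_inj; apply/eqP; rewrite setCT -cards_eq0 cCD (negPf en).
  by rewrite -[X]setIT -DT; apply: inU => j; apply: evAB.
have /cards1P[i eD] : #|~: D| == 1 by rewrite cCD on.
pose A1 := [set X in A | i \in X].
have cA1 : #|A1| <= k - 1.
  rewrite leqNgt; apply/negP=> ltk.
  have [||S [_ sSA1 cS]] := @intermediate_subset _ set0 A1 k.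
  - exact: sub0set.
  - by rewrite cards0; lia.
  have SA1 X : X \in S -> X \in A /\ i \in X.
    by move=> /(subsetP sSA1); rewrite inE => /andP.
  have sSA : S \subset A by apply/subsetP=> X /SA1[].
  (* [Z] consists of whole pairs and the point [i], so its size is odd. *)
  case/negP: (hA S sSA cS); set Z := \bigcap_(X in S) X.
  have iZ : i \in Z by apply/bigcapP=> X /SA1[].
  have evZ j : ~~ odd #|Z :&: B j|.
    by apply: even_meet_bigcap => // X /SA1[XA _]; apply: evAB.
  rewrite -(cardsID D Z) oddD (bigcup_pairs_all_even pairsB evZ).
  rewrite (card_bigcup_pairs pairsB) oddM /= setDE eD.
  by rewrite (setIidPr _) ?cards1 // sub1set.
pose C0 := [set X :&: D | X in A1].
have sC0U : C0 \subset U.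
  apply/subsetP=> _ /imsetP[X + ->]; rewrite inE => /andP[XA _].
  by apply: inU => j; apply: evAB.
(* Type (ii) asks for exactly [k - 1] sets, so the traces [C0] are padded within [U]. *)
have [|C [sC0C sCU cC]] := intermediate_subset sC0U (m := k - 1).
  by rewrite (leq_trans (leq_imset_card _ _)) //= card_union_family //; lia.
pose f (l : 'I_(k - 1)) := enum_val (cast_ord (esym cC) l).
exists (U :|: [set f l :|: [set i] | l : 'I_(k - 1)]); split.
  right; split=> //; exists B, i, f; split=> //.
    by move=> l1 l2 /enum_val_inj/cast_ord_inj.
  by move=> l; apply: (subsetP sCU); apply: enum_valP.
apply/subsetP=> X XA; have XDU := inU X (fun j => evAB X j XA).
rewrite inE; have [iX|iX] := boolP (i \in X); last first.
  suff -> : X = X :&: D by rewrite XDU.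
  apply/esym/setIidPl; rewrite -[D]setCK eD -disjoints_subset.
  by rewrite disjoint_sym disjoints1.
apply/orP; right; apply/imsetP.
have XC : X :&: D \in C.
  by apply: (subsetP sC0C); apply: imset_f; rewrite inE XA.
exists (cast_ord cC (enum_rank_in XC (X :&: D))) => //.
rewrite /f cast_ordK enum_rankK_in // -eD setUIl setUCr setIT.
by apply/esym/setUidPl; rewrite eD sub1set.
Qed.

Local Open Scope ring_scope.

(* up_log 2 m is the ceiling of the base-2 logarithm of m (m >= 1). *)
Theorem theorem1p3 (k n : nat) (A : {set {set 'I_n}})
    (hk : (3 <= k)%N)
    (hn : (2 * up_log 2 (k - 1) + 4 <= n)%N)
    (hA : kwise_eventown k A)
    (hcard : 3 / 4 * 2 ^+ n./2 + (k%:R - 1) * n%:R < #|A|%:R :> rat) :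
  exists F : {set {set 'I_n}}, (type_i F \/ type_ii k F) /\ A \subset F.
Proof.
apply: kwise_eventown_structure => //.
rewrite -(ltr_nat rat) natrD !natrM natrX natrB; last by lia.
have := hcard; set a := 2 ^+ _; set b := _ * n%:R; set c := #|A|%:R; lra.
Qed.
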